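(* Let $\alpha_1,\alpha_2,\beta$ be real numbers, let $p\in\mathbb{R}[x]$ be a monic polynomial of degree $d\geq 2$, and let \[ f(x)=\beta\left\lfloor \alpha_1\left\lfloor \alpha_2 p(x)\right\rfloor\right\rfloor . \] For $N\in\mathbb{N}^*$ let $E_N=(e_n)_{n=1}^N$ with $e_n=\chi(f(n))$. Suppose that the vector $(\alpha_2,\alpha_1\alpha_2,\alpha_1\alpha_2\beta)$ is of finite type $t$ (with $t>0$). Then there exists $\eta=\eta(f,t)>0$, depending only on $f$ and $t$, such that for every $\varepsilon>0$ \[ W(E_N)\ll N^{1-\eta+\varepsilon}, \] where the implied constant depends on $f$, $t$ and $\varepsilon$ (and not on $N$).
   Context: For real $x$, $\chi(x)=+1$ if $x-\lfloor x\rfloor<\frac12$ and $\chi(x)=-1$ if $x-\lfloor x\rfloor\geq\frac12$. For a finite sequence $E_N=(e_n)_{n=1}^N\in\{-1,+1\}^N$, the well-distribution measure is \[ W(E_N)=\max_{a,b,M}\left|\sum_{m=1}^M e_{am+b}\right|, \] where the maximum is over integers $a\in\mathbb{N}^*$, $b\in\mathbb{Z}$, $M\in\mathbb{N}^*$ with $1\leq a+b<aM+b\leq N$. A vector $(\gamma_1,\ldots,\gamma_s)\in\mathbb{R}^s$ is of finite type $t>0$ if for every $\varepsilon>0$ there is a constant $c=c(\varepsilon,\gamma_1,\ldots,\gamma_s)>0$ such that for all $(n_1,\ldots,n_s)\in\mathbb{Z}^s\setminus\{0\}$, \[ \prod_{j=1}^s\left(\max(1,|n_j|)\right)^{t+\varepsilon}\left\|\sum_{j=1}^s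 n_j\gamma_j\right\|\geq c, \] where $\|\cdot\|$ denotes the distance to the nearest integer. *)

(* Defs.v *)
From mathcomp Require Import all_boot all_order all_algebra.
From mathcomp Require Import all_classical all_reals all_analysis.

Set Implicit Arguments.
Unset Strict Implicit.
Unset Printing Implicit Defensive.

Import Order.TTheory GRing.Theory Num.Theory.
Import numFieldNormedType.Exports.

Local Open Scope classical_set_scope.
Local Open Scope ring_scope.

Definition chi (R : realType) (x : R) : R :=
  if x - (Num.floor x)%:~R < 2^-1 then 1 else -1.

(* [e 1, ..., e N] are the entries of the finite sequence; the values of [e]
   outside 1..N are never used, because every index [a * m + b] below lies
   between [a + b >= 1] and [a * M + b <= N], so [absz] is harmless.
   The set is finite, so [sup] is its maximum; for [N <= 1] it is empty and
   [sup set0 = 0]. *)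
Definition well_distribution (R : realType) (N : nat) (e : nat -> R) : R :=
  sup [set r : R | exists (a : nat) (b : int) (M : nat),
    [/\ (0 < a)%N, (0 < M)%N,
        1 <= a%:Z + b, a%:Z + b < a%:Z * M%:Z + b <= N%:Z
      & r = `| \sum_(1 <= m < M.+1) e (absz (a%:Z * m%:Z + b)) | ] ].

Definition dist_int (R : realType) (x : R) : R :=
  inf (range (fun k : int => `| x - k%:~R |)).

Definition finite_type (R : realType) (s : nat) (gamma : 'rV[R]_s) (t : R)
    : Prop :=
  0 < t /\
  forall eps : R, 0 < eps ->
    exists2 c : R, 0 < c &
      forall n : 'rV[int]_s, n != 0 ->
        c <= (\prod_(j < s) Num.max 1 `| (n 0 j)%:~R | `^ (t + eps))
             * dist_int (\sum_(j < s) (n 0 j)%:~R * gamma 0 j).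

Definition nested_floor (R : realType) (alpha1 alpha2 beta : R) (p : {poly R})
    (x : R) : R :=
  beta * (Num.floor (alpha1 * (Num.floor (alpha2 * p.[x]))%:~R))%:~R.

(* Main.v *)
(* With y = p(n) and {x} = x - floor x, the value f(n) is
     x3 - beta alpha1 {x1} - beta {x2 - alpha1 {x1}},
   where (x1, x2, x3) = y (alpha2, alpha1 alpha2, alpha1 alpha2 beta); so
   chi(f(n)) = G(x1, x2, x3) for a piecewise constant G on the torus that changes
   sign under x3 |-> x3 + 1/2, hence has mean zero on every even grid.  Fejer
   kernels centred at the points of a grid with K^3 points form a partition of
   unity by trigonometric polynomials of degree < K; replacing G by its grid
   values costs only the grid points near a discontinuity (counted by
   telescoping floors) and the tails of the kernels.  What remains are Weyl sums
   with frequencies h, |h_i| < K.  These are treated by van der Corput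
   differencing with shifts bounded by a small power H of N: every linear sum that
   appears has a slope q (h . gamma) with q <> 0 at most a small power of N, so
   the finite type hypothesis bounds it directly, and no divisor estimate is
   needed.  For progressions of step a, either the length is at most N / Y or
   a <= 2 Y, with Y a small power of N. *)

Require Import Defs.
From mathcomp Require Import all_boot all_order all_algebra.
From mathcomp Require Import all_classical all_reals all_analysis.
From mathcomp Require Import complex ring lra zify.

Set Implicit Arguments.
Unset Strict Implicit.
Unset Printing Implicit Defensive.

Import Order.TTheory GRing.Theory Num.Theory.
Import numFieldNormedType.Exports.
Import ComplexField.Normc.

Local Open Scope ring_scope.

(** * Exponential sums and Weyl differencing *)

Section ExponentialSums.

Variable R : realType.
Implicit Types (x y : R) (z : R[i]) (k : int).

Lemma normc_ge0 z : 0 <= normc z.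
Proof. by case: z => a b; rewrite /= sqrtr_ge0. Qed.

Lemma normc_sum (I : Type) (s : seq I) (P : pred I) (f : I -> R[i]) :
  normc (\sum_(i <- s | P i) f i) <= \sum_(i <- s | P i) normc (f i).
Proof.
elim/big_ind2: _ => [|u1 u2 v1 v2 h1 h2|i _] //; first by rewrite normc0.
by rewrite (le_trans (le_normcD _ _)) // lerD.
Qed.

Lemma normc_real x : normc (x%:C)%C = `|x|.
Proof. by rewrite /normc /= expr0n addr0 sqrtr_sqr. Qed.

Definition expi x : R[i] :=
  Complex (cos (2 * pi * x)) (sin (2 * pi * x)).

Lemma expiD x y : expi (x + y) = expi x * expi y.
Proof.
apply/eqP; rewrite eq_complex /= mulrDr cosD sinD eqxx /=; apply/eqP; ring.
Qed.

Lemma expi0 : expi 0 = 1.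
Proof. by apply/eqP; rewrite eq_complex /= mulr0 cos0 sin0 !eqxx. Qed.

Lemma normc_expi x : normc (expi x) = 1.
Proof. by rewrite /normc /expi cos2Dsin2 sqrtr1. Qed.

Lemma expi_nat (n : nat) : expi n%:R = 1.
Proof.
elim: n => [|n IHn]; first exact: expi0.
rewrite -natr1 expiD IHn mul1r /expi mulr1 mulr_natl cos2pi sin2pi.
by apply/eqP; rewrite eq_complex /= !eqxx.
Qed.

Lemma expi_int k : expi k%:~R = 1.
Proof.
case: (intP k) => [|n|n]; [exact: expi0 | exact: expi_nat |].
have := expiD (- n.+1%:R) n.+1%:R.
by rewrite addNr expi0 expi_nat mulr1 intrN => <-.
Qed.

Lemma expiDz x k : expi (x + k%:~R) = expi x.
Proof. by rewrite expiD expi_int mulr1. Qed.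

Lemma expi_mulrn (n : nat) x : expi (n%:R * x) = expi x ^+ n.
Proof.
elim: n => [|n IHn]; first by rewrite mul0r expi0.
by rewrite -natr1 mulrDl mul1r expiD IHn exprSr.
Qed.

(** The squared norm is [z] times its conjugate, and conjugation sends [expi y] to [expi (- y)]. The
    equation lives in [R[i]] because the terms of the double sum are complex. *)
Lemma normc_sum_expi_sqr (I : finType) (f : I -> R) :
  ((normc (\sum_i expi (f i)) ^+ 2)%:C)%C =
  \sum_i \sum_j expi (f i - f j).
Proof.
have -> (z : R[i]) : ((normc z ^+ 2)%:C)%C = z * (conjc z).
  by rewrite -sqr_normc /normc normc_def; case: z => a b /=; rewrite rmorphXn.
rewrite rmorph_sum /= big_distrlr /=; apply: eq_bigr => i _; apply: eq_bigr => j _.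
rewrite expiD; congr (_ * _).
by apply/eqP; rewrite eq_complex /= mulrN cosN sinN !eqxx.
Qed.

(* A multiple [n y] with [n <= 1 / (2 y)] lies in [1/4, 1/2], where
   [|1 - expi (n y)| >= 1]; and [|1 - expi (n y)| <= n |1 - expi y|]. *)
Lemma normc_1Bexpi_ge_half y : 0 < y <= 2^-1 -> 2 * y <= normc (1 - expi y).
Proof.
move=> /andP[y0 y1].
have [n /andP[n1 n2]] : exists n : nat, (4^-1 <= n%:R * y <= 2^-1).
  have [y4|y4] := leP 4^-1 y; first by exists 1%N; rewrite mul1r y4.
  have h0 : 0 <= (2 * y)^-1 by rewrite invr_ge0; lra.
  have /andP[h1 h2] := truncn_itv h0.
  exists (Num.truncn (2 * y)^-1).
  have E : (2 * y)^-1 * y = 2^-1 by field; rewrite gt_eqF.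
  apply/andP; split; last by rewrite -E ler_pM2r.
  move: h2; rewrite -natr1 -(ltr_pM2r y0) E; lra.
have n0 : (0 < n)%N by case: n n1 {n2} => //; rewrite mul0r; lra.
have hle : normc (1 - expi (n%:R * y)) <= n%:R * normc (1 - expi y).
  rewrite expi_mulrn -[1 - expi y ^+ n]opprB subrX1 normcN normcM mulrC.
  rewrite -[normc (1 - _)]normcN opprB ler_wpM2r ?normc_ge0 //.
  rewrite (le_trans (normc_sum _ _ _)) // -[leRHS]mulr1 mulr_natl.
  rewrite (eq_bigr (fun=> 1)) ?sumr_const ?card_ord // => i _.
  by rewrite -expi_mulrn normc_expi.
have hge : 1 <= normc (1 - expi (n%:R * y)).
  have pi0 := pi_gt0 R.
  have c0 : cos (2 * pi * (n%:R * y)) <= 0.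
    rewrite -[2 * _ * _](subrK (pi / 2)) cosDpihalf oppr_le0 sin_ge0_pi //.
    set v := n%:R * y in n1 n2 *.
    apply/andP; split.
      have : 0 <= pi * (v - 4^-1) by rewrite mulr_ge0 ?subr_ge0 // ltW.
      lra.
    have : 0 <= pi * (2^-1 - v) by rewrite mulr_ge0 ?subr_ge0 // ltW.
    lra.
  rewrite /normc /expi /= -[leLHS]sqrtr1 ler_sqrt ?addr_ge0 ?sqr_ge0 //.
  move: c0 (cos2Dsin2 (2 * pi * (n%:R * y))).
  move: (cos _) (sin _) => c s; move=> c0 cs.
  have -> : (1 - c) ^+ 2 + (0 - s) ^+ 2 = 1 + (c ^+ 2 + s ^+ 2) - 2 * c by ring.
  by rewrite cs; lra.
have := le_trans hge hle; set w := normc _ => h.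
have w0 : 0 <= w by exact: normc_ge0.
have : n%:R * (2 * y) <= n%:R * w by rewrite (le_trans _ h) //; lra.
by rewrite ler_pM2l // ltr0n.
Qed.

(** Only the fractional part [v] of [y] matters, and [1 - expi v = - expi v * (1 - expi (1 - v))]
    reduces [v > 1/2] to the half interval. *)
Lemma normc_1Bexpi_ge y r : (forall k, r <= `|y - k%:~R|) ->
  2 * r <= normc (1 - expi y).
Proof.
move=> hr; pose v := y - (Num.floor y)%:~R.
have /andP[f1 f2] := floor_itv y; rewrite intrD mulr1z in f2.
have -> : expi y = expi v by rewrite -[y](subrK (Num.floor y)%:~R) expiDz.
have r1 : r <= v by have := hr (Num.floor y); rewrite ger0_norm // subr_ge0.
have r2 : r <= 1 - v.
  have := hr (Num.floor y + 1); rewrite intrD mulr1z /v => h.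
  by move: h; rewrite ler0_norm; lra.
have [r0|r0] := leP r 0.
  by rewrite (le_trans _ (normc_ge0 _)) //; lra.
have [vh|vh] := leP v 2^-1.
  apply: le_trans (normc_1Bexpi_ge_half _); first by lra.
  by apply/andP; split; lra.
have -> : normc (1 - expi v) = normc (1 - expi (1 - v)).
  have -> : 1 - expi v = - expi v * (1 - expi (1 - v)).
    rewrite mulrBr mulr1 mulNr -expiD (_ : v + (1 - v) = 1%:~R) ?expi_int; last by ring.
    by rewrite opprK addrC.
  by rewrite normcM normcN normc_expi mul1r.
apply: le_trans (normc_1Bexpi_ge_half _); first by lra.
by apply/andP; split; lra.
Qed.

(** Multiplied by [1 - expi y] the sum telescopes to a quantity of norm at most 2, while
    [1 - expi y] has norm at least [2 r]. *)
Lemma geometric_sum_expi_le y r (M : nat) : 0 < r ->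
  (forall k, r <= `|y - k%:~R|) ->
  normc (\sum_(m < M) expi (m%:R * y)) <= r^-1.
Proof.
move=> r0 hr; have h := normc_1Bexpi_ge hr.
have : normc (1 - expi y) * normc (\sum_(m < M) expi (m%:R * y)) <= 2.
  rewrite -normcM (eq_bigr (fun m : 'I_M => expi y ^+ m)); last first.
    by move=> m _; rewrite expi_mulrn.
  rewrite -[1 - _]opprB mulNr -subrX1 normcN (le_trans (le_normcD _ _)) //.
  by rewrite normcN normc1 -expi_mulrn normc_expi.
move: (normc_ge0 (\sum_(m < M) expi (m%:R * y))) h.
set S := normc (\sum_(m < M) _); set w := normc _ => S0 h hw.
rewrite -[_^-1]mul1r ler_pdivlMr //; nra.
Qed.

(* Van der Corput's inequality: the sum is compared with its average over the
   shifts by [r < H]. *)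
Lemma van_der_corput (f : nat -> R) (M H : nat) (B l : R) :
  (0 < H)%N -> 0 < l -> 0 <= B ->
  (forall r s, (r < H)%N -> (s < H)%N -> r != s ->
     normc (\sum_(m < M) expi (f (m + r)%N - f (m + s)%N)) <= B) ->
  normc (\sum_(m < M) expi (f m)) <=
    2 * H%:R + M%:R * l / 2 + (M%:R / H%:R + B) / (2 * l).
Proof.
move=> H0 l0 B0 hB.
have HR : 0 < H%:R :> R by rewrite ltr0n.
set S := \sum_(m < M) expi (f m).
pose T m : R[i] := \sum_(r < H) expi (f (m + r)%N).
(* A shift by one exchanges a single term at each end, at a cost of at most 2. *)
have shift (r : nat) : normc (S - \sum_(m < M) expi (f (m + r)%N)) <= 2 * r%:R.
  elim: r => [|r IHr].
    rewrite (eq_bigr (fun m : 'I_M => expi (f m))) => [|m _]; last by rewrite addn0.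
    by rewrite subrr normc0 mulr0.
  have -> : \sum_(m < M) expi (f (m + r.+1)%N) =
      \sum_(m < M) expi (f (m + r)%N) + (expi (f (M + r)%N) - expi (f r)).
    apply/eqP; rewrite addrA eq_sym subr_eq -(big_ord_recr M (fun m => expi (f (m + r)%N))) /=.
    rewrite big_ord_recl add0n addrC; apply/eqP; congr (_ + _).
    by apply: eq_bigr => m _; rewrite /= /bump add1n addSnnS.
  rewrite opprD addrA (le_trans (le_normcD _ _)) // -[r.+1%:R]natr1 (mulrDr 2 r%:R 1) lerD //.
  by rewrite normcN (le_trans (le_normcD _ _)) // normcN !normc_expi mulr1.
have h1 : H%:R * normc S <= H%:R * (2 * H%:R) + \sum_(m < M) normc (T m).
  have -> : H%:R * normc S = normc (\sum_(r < H) S).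
    by rewrite sumr_const card_ord normcMn mulr_natl.
  have -> : \sum_(r < H) S = \sum_(r < H) (S - \sum_(m < M) expi (f (m + r)%N))
      + \sum_(m < M) T m.
    rewrite [X in _ = _ + X]exchange_big /= -big_split /=.
    by apply: eq_bigr => r _; rewrite subrK.
  rewrite (le_trans (le_normcD _ _)) // lerD ?normc_sum //.
  rewrite (le_trans (normc_sum _ _ _)) // mulr_natl.
  rewrite -[X in _ *+ X]card_ord -sumr_const ler_sum // => r _.
  by rewrite (le_trans (shift _)) // ler_wpM2l // ler_nat ltnW.
(* In the expanded squares each diagonal pair [r = s] contributes [M] and every other pair at most
   [B]. *)
have h2 : \sum_(m < M) normc (T m) ^+ 2 <= H%:R * M%:R + H%:R ^+ 2 * B.
  have E : ((\sum_(m < M) normc (T m) ^+ 2)%:C)%C = \sum_(r < H) \sum_(s < H)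
      \sum_(m < M) expi (f (m + r)%N - f (m + s)%N).
    rewrite rmorph_sum /= (eq_bigr _ (fun m _ => normc_sum_expi_sqr _)) exchange_big /=.
    by apply: eq_bigr => r _; rewrite exchange_big.
  have -> : \sum_(m < M) normc (T m) ^+ 2 = normc ((\sum_(m < M) normc (T m) ^+ 2)%:C)%C.
    by rewrite normc_real ger0_norm // sumr_ge0 // => m _; rewrite sqr_ge0.
  rewrite E (le_trans (normc_sum _ _ _)) //.
  have -> : H%:R * M%:R + H%:R ^+ 2 * B = \sum_(r < H) (M%:R + H%:R * B).
    by rewrite sumr_const card_ord -mulr_natl; ring.
  apply: ler_sum => r _; rewrite (le_trans (normc_sum _ _ _)) //.
  rewrite (bigD1 r) //= lerD //.
    rewrite (le_trans (normc_sum _ _ _)) // (eq_bigr (fun=> 1)) => [|m _].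
      by rewrite sumr_const card_ord.
    by rewrite normc_expi.
  have -> : H%:R * B = \sum_(s < H) B by rewrite sumr_const card_ord mulr_natl.
  rewrite [leRHS](bigD1 r) //= -[leLHS]add0r lerD //.
  by apply: ler_sum => s rs; rewrite hB // eq_sym.
(* The inequality [a <= (a ^ 2 / w + w) / 2] with [w = H l] replaces Cauchy-Schwarz and leaves [l]
   to be chosen later. *)
have h3 : \sum_(m < M) normc (T m) <=
    ((H%:R * M%:R + H%:R ^+ 2 * B) / (H%:R * l) + M%:R * (H%:R * l)) / 2.
  have Hl : 0 < H%:R * l by rewrite mulr_gt0.
  apply: (@le_trans _ _ (\sum_(m < M) (normc (T m) ^+ 2 / (H%:R * l) + H%:R * l) / 2)).
    apply: ler_sum => m _; set a := normc _; rewrite ler_pdivlMr //.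
    rewrite -(ler_pM2r Hl) mulrDl divfK ?gt_eqF //.
    have := sqr_ge0 (a - H%:R * l); nra.
  rewrite -mulr_suml big_split /= -mulr_suml sumr_const card_ord -(mulr_natl (_ * l) M).
  by rewrite ler_pM2r // lerD2r ler_pM2r ?invr_gt0.
rewrite -(ler_pM2l HR) (le_trans h1) // -addrA mulrDr lerD2l (le_trans h3) //.
by rewrite le_eqVlt; apply/orP; left; apply/eqP; field; rewrite !gt_eqF.
Qed.

Definition fdiff (f : nat -> R) (m : nat) : R := f m.+1 - f m.

Lemma fdiffE (f : nat -> R) (m : nat) : fdiff f m = f m.+1 - f m.
Proof. by []. Qed.

Lemma eq_iter_fdiff (k : nat) (f g : nat -> R) :
  f =1 g -> iter k fdiff f =1 iter k fdiff g.
Proof. by move=> fg; elim: k => // k IHk m; rewrite !iterS !fdiffE !IHk. Qed.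

Lemma iter_fdiff_shiftB (k : nat) (f : nat -> R) (r s m : nat) :
  iter k fdiff (fun m => f (m + r)%N - f (m + s)%N) m =
  iter k fdiff f (m + r)%N - iter k fdiff f (m + s)%N.
Proof.
elim: k m => [//|k IHk] m; rewrite !iterS !fdiffE !IHk !addSn; ring.
Qed.

Lemma fdiff_const (f : nat -> R) (L : R) : fdiff f =1 (fun=> L) ->
  forall m, f m = f 0%N + m%:R * L.
Proof.
move=> hf; elim=> [|m IHm]; first by rewrite mul0r addr0.
have := hf m; rewrite /fdiff => /eqP; rewrite subr_eq => /eqP ->.
by rewrite IHm -natr1; ring.
Qed.

Lemma absz_subn_lt (r s H : nat) :
  (r < H)%N -> (s < H)%N -> (`|r%:Z - s%:Z| < H)%N.
Proof. lia. Qed.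

(* Weyl differencing with shifts below a short length [H]: the only arithmetic
   input is a lower bound for [q L] modulo 1 at small [q]. *)
Lemma weyl_bound (k : nat) (f : nat -> R) (L sigma : R) (M H : nat) :
  (0 < M)%N -> (0 < H)%N -> 0 < sigma <= 1 ->
  H%:R^-1 <= sigma -> H%:R <= sigma * M%:R ->
  (forall q : int, q != 0 -> (`|q| <= H ^ k)%N ->
     forall j : int, (sigma * M%:R)^-1 <= `|q%:~R * L - j%:~R|) ->
  iter k.+1 fdiff f =1 (fun=> L) ->
  normc (\sum_(m < M) expi (f m)) <= 8 * M%:R * iter k Num.sqrt sigma.
Proof.
move=> M0 H0 /andP[s0 s1] Hs HM.
have MR : 0 < M%:R :> R by rewrite ltr0n.
elim: k f L => [|k IHk] f L hq hf.
  have {}hf := fdiff_const hf.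
  rewrite (eq_bigr (fun m : 'I_M => expi (f 0%N) * expi (m%:R * L))) => [|m _]; last first.
    by rewrite -expiD -hf.
  rewrite -mulr_sumr normcM normc_expi mul1r.
  have sM : 0 < sigma * M%:R by rewrite mulr_gt0.
  rewrite (le_trans (@geometric_sum_expi_le L (sigma * M%:R)^-1 M _ _)) ?invr_gt0 //.
    by move=> j; have := hq 1 isT isT j; rewrite mul1r.
  by rewrite invrK /=; nra.
have itP (i : nat) : [/\ 0 < iter i Num.sqrt sigma, iter i Num.sqrt sigma <= 1 &
    sigma <= iter i Num.sqrt sigma].
  elim: i => [|i [h1 h2 h3]]; first by split.
  rewrite iterS; set u := iter i _ _ in h1 h2 h3 *.
  have v0 : 0 < Num.sqrt u by rewrite sqrtr_gt0.
  have v1 : Num.sqrt u <= 1 by rewrite -[leRHS]sqrtr1 ler_wsqrtr.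
  split=> //; rewrite (le_trans h3) // -[leLHS](sqr_sqrtr (ltW h1)).
  by rewrite expr2 -[leRHS]mulr1 ler_pM2l.
have [u0 u1 us] := itP k; have [v0 v1 vs] := itP k.+1.
have vv : Num.sqrt (iter k Num.sqrt sigma) ^+ 2 = iter k Num.sqrt sigma.
  by rewrite sqr_sqrtr // ltW.
rewrite iterS in v0 v1 vs *.
set u := iter k _ _ in u0 u1 us IHk vv v0 v1 vs *; set v := Num.sqrt u in vv v0 v1 vs *.
(* With [l = 3 v] and [v ^ 2 = u] the three terms are at most [2 M v], [3/2 M v] and [3/2 M v], the
   last because [1 / H <= sigma <= u]. *)
have := @van_der_corput f M H (8 * M%:R * u) (3 * v) H0.
have B0 : 0 <= 8 * M%:R * u by rewrite !mulr_ge0 // ltW.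
have v30 : 0 < 3 * v by rewrite mulr_gt0.
move/(_ v30 B0) => hv; apply: (le_trans (hv _)) => {hv}.
  move=> r s rH sH rs.
  (* Differencing by the shifts [r], [s] multiplies the slope by [r - s], so the admissible
     multipliers shrink from [H ^ k.+1] to [H ^ k]. *)
  apply: (IHk (fun m => f (m + r)%N - f (m + s)%N) ((r%:Z - s%:Z)%:~R * L)).
    move=> q q0 qH j; rewrite mulrA -intrM; apply: hq.
      by rewrite mulf_neq0 // subr_eq0.
    rewrite abszM expnS mulnC leq_mul //.
    by rewrite ltnW // absz_subn_lt.
  have hf' n : iter k.+1 fdiff f n = iter k.+1 fdiff f 0%N + n%:R * L.
    exact: fdiff_const hf n.
  have E n : iter k fdiff f n.+1 = iter k fdiff f n + iter k.+1 fdiff f n.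
    by rewrite iterS fdiffE addrC subrK.
  move=> m; rewrite iterS fdiffE !iter_fdiff_shiftB (addSn m r) (addSn m s).
  rewrite (E (m + r)%N) (E (m + s)%N) (hf' (m + r)%N) (hf' (m + s)%N).
  rewrite !natrD intrB -!pmulrn; ring.
have -> : (M%:R / H%:R + 8 * M%:R * u) / (2 * (3 * v)) =
    M%:R * (H%:R^-1 + 8 * u) / (6 * v) by field; rewrite !gt_eqF ?ltr0n.
have h1 : M%:R * (H%:R^-1 + 8 * u) / (6 * v) <= M%:R * (3 / 2 * v).
  rewrite ler_pdivrMr ?mulr_gt0 // -[leRHS]mulrA ler_pM2l //.
  rewrite (_ : 3 / 2 * v * (6 * v) = 9 * v ^+ 2); last by field.
  rewrite vv; lra.
have h2 : 2 * H%:R <= M%:R * (2 * v).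
  have : sigma * M%:R <= v * M%:R by rewrite ler_pM2r.
  lra.
have Mv : 0 < M%:R * v by rewrite mulr_gt0.
rewrite (le_trans (lerD (lerD h2 (lexx _)) h1)) //.
have : forall w : R, 0 < M%:R * w -> M%:R * (2 * w) + M%:R * (3 * w) / 2 +
    M%:R * (3 / 2 * w) <= 8 * M%:R * w by move=> w; lra.
exact.
Qed.

End ExponentialSums.

(** * Finite differences of polynomial phases *)

Section PolynomialPhase.

Variable R : realType.

(** Each difference lowers the degree bound by one and multiplies the top coefficient by that
    bound. *)
Lemma iter_fdiff_horner (d : nat) (P : {poly R}) : (size P <= d.+1)%N ->
  iter d (@fdiff R) (fun m => P.[m%:R]) =1 (fun=> d`!%:R * P`_d).
Proof.
elim: d P => [|d IHd] P sP m.
  by rewrite /= [in LHS](size1_polyC sP) hornerC mul1r.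
(* By Taylor's formula with normalised derivatives, [Q] is [P (x + 1) - P x]. *)
pose Q := \sum_(i < d.+1) P^`N(i.+1).
have cQ j : Q`_j = \sum_(i < d.+1) P`_(i.+1 + j) *+ 'C(i.+1 + j, i.+1).
  by rewrite /Q coef_sum; apply: eq_bigr => i _; rewrite coef_nderivn.
have sQ : (size Q <= d.+1)%N.
  apply/leq_sizeP => j dj; rewrite cQ big1 // => i _.
  by rewrite nth_default ?mul0rn // (leq_trans sP) // addSn ltnS (leq_trans dj) ?leq_addl.
rewrite iterSr (@eq_iter_fdiff _ d _ (fun m => Q.[m%:R])) => [|n].
  rewrite IHd // cQ big_ord_recl /= big1 ?addr0 => [|i _]; last first.
    rewrite nth_default ?mul0rn // (leq_trans sP) // /bump /=.
    by rewrite !addSn !ltnS leq_addl.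
  by rewrite add1n bin1 factS natrM -mulr_natr; ring.
rewrite fdiffE -natr1 (nderiv_taylor_wide (n := d.+2)) //; last exact: mulrC.
rewrite big_ord_recl nderivn0 expr1n mulr1 addrAC subrr add0r horner_sum.
by apply: eq_bigr => i _; rewrite expr1n mulr1.
Qed.

Lemma iter_fdiff_monic_comp_affine (d : nat) (p : {poly R}) (theta a b : R) :
  p \is monic -> size p = d.+1 -> a != 0 ->
  iter d (@fdiff R) (fun m => theta * p.[a * m%:R + b]) =1
    (fun=> d`!%:R * (theta * a ^+ d)).
Proof.
move=> /monicP pm sp a0 m.
pose A : {poly R} := a *: 'X + b%:P.
have sA : size A = 2%N.
  by rewrite /A size_addl size_scale ?size_polyX // (leq_ltn_trans (size_polyC_leq1 _)).
have sB : size (p \Po A) = d.+1 by rewrite size_comp_poly2.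
rewrite (@eq_iter_fdiff _ d _ (fun m => (theta *: (p \Po A)).[m%:R])) => [|n].
  rewrite iter_fdiff_horner ?(leq_trans (size_scale_leq _ _)) ?sB // coefZ.
  have -> : (p \Po A)`_d = lead_coef (p \Po A) by rewrite /lead_coef sB.
  rewrite lead_coef_comp ?sA // pm mul1r sp /=.
  rewrite lead_coefDl ?lead_coefZ ?lead_coefX ?mulr1 //.
  by rewrite size_scale ?size_polyX // (leq_ltn_trans (size_polyC_leq1 _)).
by rewrite hornerZ horner_comp /A !hornerE.
Qed.

End PolynomialPhase.

(** * A partition of unity by Fejer kernels *)

Section Fejer.

Variable R : realType.
Implicit Types (x y : R) (K : nat).

(* The normalisation makes the translates by [j / K] a partition of unity. *)
Definition fejer K y : R :=
  normc (\sum_(l < K) expi (l%:R * y)) ^+ 2 / K%:R ^+ 2.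

Lemma fejer_ge0 K y : 0 <= fejer K y.
Proof. by rewrite divr_ge0 ?exprn_ge0 ?normc_ge0. Qed.

Lemma fejer_le K y r : 0 < r -> (forall k : int, r <= `|y - k%:~R|) ->
  fejer K y <= (K%:R * r) ^- 2.
Proof.
move=> r0 hr; rewrite exprMn invfM /fejer mulrC ler_wpM2l ?invr_ge0 ?exprn_ge0 //.
by rewrite -exprVn lerXn2r ?nnegrE ?normc_ge0 ?invr_ge0 ?(ltW r0) ?geometric_sum_expi_le.
Qed.

(** Orthogonality of characters modulo [K]: for [c] nonzero, [c / K] has distance at least [1 / K]
    from the integers, so [expi (c / K)] is a [K]-th root of unity other than 1. *)
Lemma sum_expi_root K (c : int) : (0 < K)%N -> (`|c| < K)%N ->
  \sum_(j < K) expi (c%:~R * (j%:R / K%:R) : R) = if c == 0 then K%:R else 0.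
Proof.
move=> K0 cK; have KR : 0 < K%:R :> R by rewrite ltr0n.
have [->|c0] := eqVneq.
  by under eq_bigr => j _ do rewrite mul0r expi0; rewrite sumr_const card_ord.
have E (j : nat) : expi (c%:~R * (j%:R / K%:R) : R) = expi (c%:~R / K%:R : R) ^+ j.
  by rewrite -expi_mulrn; congr expi; ring.
under eq_bigr => j _ do rewrite E.
have ck k : K%:R^-1 <= `|c%:~R / K%:R - k%:~R| :> R.
  have -> : c%:~R / K%:R - k%:~R = (c - k * K%:Z)%:~R / K%:R :> R.
    by rewrite intrB intrM -pmulrn; field; rewrite gt_eqF.
  rewrite normrM [X in _ * X]gtr0_norm ?invr_gt0 // ler_peMl ?invr_ge0 ?ler0n //.
  rewrite -intr_norm ler1z -gtz0_ge1 normr_gt0 subr_eq0.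
  apply: contraTneq cK => cE; rewrite -leqNgt cE abszM /= leq_pmull //.
  by rewrite absz_gt0; apply: contraNneq c0 => k0; rewrite cE k0 mul0r.
have e1 : expi (c%:~R / K%:R : R) - 1 != 0.
  apply/eqP => e0; have := normc_1Bexpi_ge ck.
  rewrite -opprB e0 oppr0 normc0 pmulr_rle0 // leNgt invr_gt0.
  by rewrite KR.
apply: (mulfI e1); rewrite -subrX1 mulr0 -expi_mulrn mulrC divfK ?gt_eqF //.
by rewrite expi_int subrr.
Qed.

(** After expanding the square, summation over [j] kills the pairs [l != l'], and each of the [K]
    diagonal pairs gives [K]. *)
Lemma sum_fejer_translates K x : (0 < K)%N ->
  \sum_(j < K) fejer K (x - j%:R / K%:R) = 1.
Proof.
move=> K0; have KR : K%:R != 0 :> R by rewrite pnatr_eq0 -lt0n.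
rewrite -mulr_suml; suff -> : \sum_(j < K)
    normc (\sum_(l < K) expi (l%:R * (x - j%:R / K%:R))) ^+ 2 = K%:R ^+ 2.
  by rewrite divff // expf_neq0.
apply: complexI; rewrite rmorph_sum /=.
rewrite (eq_bigr _ (fun j _ => normc_sum_expi_sqr _)) exchange_big /=.
transitivity (\sum_(l < K) (K%:R : R[i])); last first.
  by rewrite sumr_const card_ord -natrX rmorph_nat -mulrnA mulnn.
apply: eq_bigr => l _; rewrite exchange_big /=.
have E (l' : 'I_K) : \sum_(j < K) expi (l%:R * (x - j%:R / K%:R) -
      l'%:R * (x - j%:R / K%:R)) =
    expi ((l%:R - l'%:R) * x) * (if l'%:Z - l%:Z == 0 then K%:R else 0) :> R[i].
  rewrite -sum_expi_root // ?absz_subn_lt // mulr_sumr.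
  by apply: eq_bigr => j _; rewrite -expiD intrB -!pmulrn; congr expi; ring.
rewrite (eq_bigr _ (fun l' _ => E l')) (bigD1 l) //= big1 ?addr0 => [|l' ll'].
  by rewrite !subrr mul0r expi0 mul1r.
by rewrite subr_eq0 eqz_nat (negbTE (_ : val l' != val l)) ?mulr0.
Qed.

Lemma big_triple (V : comNzRingType) (I J L : finType) (a : I -> V) (b : J -> V)
    (c : L -> V) :
  \sum_(j : I * J * L) a j.1.1 * b j.1.2 * c j.2 =
  (\sum_i a i) * (\sum_i b i) * (\sum_i c i).
Proof.
rewrite big_distrlr /= pair_big /= mulr_suml.
rewrite -(pair_bigA _ (fun j l => a j.1 * b j.2 * c l)) /=.
by apply: eq_bigr => j _; rewrite mulr_sumr.
Qed.

Definition grid K : finType := ('I_K * 'I_K * 'I_K)%type.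

Lemma card_grid K : #|grid K| = (K ^ 3)%N.
Proof. by rewrite /grid /= !card_prod !card_ord !expnS expn0 muln1 mulnA. Qed.

Definition dot3 (h1 h2 h3 x1 x2 x3 : R) : R := h1 * x1 + h2 * x2 + h3 * x3.

Definition gdot K (l : grid K) (x1 x2 x3 : R) : R :=
  dot3 (l.1.1)%:R (l.1.2)%:R (l.2)%:R x1 x2 x3.

Definition fejer3 K (j : grid K) (x1 x2 x3 : R) : R :=
  fejer K (x1 - (j.1.1)%:R / K%:R) * fejer K (x2 - (j.1.2)%:R / K%:R) *
  fejer K (x3 - (j.2)%:R / K%:R).

Lemma fejer3_ge0 K (j : grid K) x1 x2 x3 : 0 <= fejer3 j x1 x2 x3.
Proof. by apply: mulr_ge0; [apply: mulr_ge0|]; exact: fejer_ge0. Qed.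

Lemma sum_fejer3 K x1 x2 x3 : (0 < K)%N ->
  \sum_(j : grid K) fejer3 j x1 x2 x3 = 1.
Proof.
move=> K0; pose F x (i : 'I_K) := fejer K (x - i%:R / K%:R).
rewrite (big_triple (F x1) (F x2) (F x3)) /F.
by rewrite !sum_fejer_translates // !mulr1.
Qed.

(** The point [x] and the grid point [j] sit in separate factors of each frequency term, so sums
    over [m] and over [j] decouple. *)
Lemma fejer3E K (j : grid K) x1 x2 x3 :
  ((fejer3 j x1 x2 x3)%:C)%C = (K%:R ^- 6) * \sum_(l : grid K) \sum_(l' : grid K)
    (expi (dot3 ((l.1.1)%:R - (l'.1.1)%:R) ((l.1.2)%:R - (l'.1.2)%:R)
               ((l.2)%:R - (l'.2)%:R) x1 x2 x3) *
     expi (dot3 ((l'.1.1)%:R - (l.1.1)%:R) ((l'.1.2)%:R - (l.1.2)%:R)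
               ((l'.2)%:R - (l.2)%:R) ((j.1.1)%:R / K%:R) ((j.1.2)%:R / K%:R)
               ((j.2)%:R / K%:R))).
Proof.
set y1 := x1 - (j.1.1)%:R / K%:R; set y2 := x2 - (j.1.2)%:R / K%:R.
set y3 := x3 - (j.2)%:R / K%:R.
pose S y := \sum_(l < K) expi (l%:R * y) : R[i].
have -> : fejer3 j x1 x2 x3 =
    K%:R ^- 6 * normc (\sum_(l : grid K) expi (gdot l y1 y2 y3)) ^+ 2.
  have -> : \sum_(l : grid K) expi (gdot l y1 y2 y3) = S y1 * S y2 * S y3.
    rewrite -big_triple; apply: eq_bigr => l _.
    by rewrite /gdot /dot3 !expiD.
  rewrite !normcM /fejer3 /fejer -/y1 -/y2 -/y3 -/(S y1) -/(S y2) -/(S y3).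
  rewrite !exprMn (_ : K%:R ^- 6 = (K%:R ^+ 2)^-1 * (K%:R ^+ 2)^-1 * (K%:R ^+ 2)^-1).
    by ring.
  by rewrite -!invfM -!exprD.
rewrite rmorphM /= fmorphV rmorphXn rmorph_nat normc_sum_expi_sqr; congr (_ * _).
apply: eq_bigr => l _; apply: eq_bigr => l' _; rewrite -expiD; congr expi.
by rewrite /gdot /dot3 /y1 /y2 /y3; ring.
Qed.

(* Only the diagonal frequencies [l = l'] contribute a main term. *)
Lemma weighted_fejer_sum_le K M (w : grid K -> R) (x1 x2 x3 : nat -> R) (B : R) :
  (0 < K)%N -> 0 <= B ->
  (forall h1 h2 h3 : int, [|| h1 != 0, h2 != 0 | h3 != 0] ->
    (`|h1| < K)%N -> (`|h2| < K)%N -> (`|h3| < K)%N ->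
    normc (\sum_(m < M) expi (dot3 h1%:~R h2%:~R h3%:~R (x1 m) (x2 m) (x3 m))) <= B) ->
  `|\sum_(m < M) \sum_j w j * fejer3 j (x1 m) (x2 m) (x3 m)| <=
    M%:R / K%:R ^+ 3 * `|\sum_j w j| + (\sum_j `|w j|) * B.
Proof.
move=> K0 B0 hB; have KR : 0 < K%:R :> R by rewrite ltr0n.
rewrite -[leLHS]normc_real.
pose A (l l' : grid K) m := expi (dot3 ((l.1.1)%:R - (l'.1.1)%:R)
  ((l.1.2)%:R - (l'.1.2)%:R) ((l.2)%:R - (l'.2)%:R) (x1 m) (x2 m) (x3 m)) : R[i].
pose D (l l' j : grid K) := expi (dot3 ((l'.1.1)%:R - (l.1.1)%:R)
  ((l'.1.2)%:R - (l.1.2)%:R) ((l'.2)%:R - (l.2)%:R) ((j.1.1)%:R / K%:R)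
  ((j.1.2)%:R / K%:R) ((j.2)%:R / K%:R)) : R[i].
have -> : ((\sum_(m < M) \sum_j w j * fejer3 j (x1 m) (x2 m) (x3 m))%:C)%C =
    K%:R ^- 6 * \sum_l \sum_l' ((\sum_(m < M) A l l' m) *
      (\sum_j ((w j)%:C)%C * D l l' j)).
  transitivity (\sum_(m < M) K%:R ^- 6 * \sum_l \sum_l' (A l l' m *
      (\sum_j ((w j)%:C)%C * D l l' j))); last first.
    rewrite -mulr_sumr; congr (_ * _); rewrite exchange_big; apply: eq_bigr => l _.
    by rewrite exchange_big; apply: eq_bigr => l' _; rewrite mulr_suml.
  rewrite rmorph_sum /=; apply: eq_bigr => m _; rewrite rmorph_sum /=.
  transitivity (\sum_j K%:R ^- 6 * \sum_l \sum_l' (A l l' m * (((w j)%:C)%C * D l l' j))).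
    apply: eq_bigr => j _; rewrite rmorphM /= fejer3E mulrCA; congr (_ * _).
    rewrite mulr_sumr; apply: eq_bigr => l _; rewrite mulr_sumr.
    by apply: eq_bigr => l' _; rewrite mulrCA.
  rewrite -mulr_sumr; congr (_ * _); rewrite exchange_big; apply: eq_bigr => l _.
  by rewrite exchange_big; apply: eq_bigr => l' _; rewrite mulr_sumr.
have -> : (K%:R : R[i]) ^- 6 = ((K%:R ^- 6)%:C)%C.
  by rewrite fmorphV rmorphXn rmorph_nat.
have K6 : 0 < K%:R ^- 6 :> R by rewrite invr_gt0 exprn_gt0.
rewrite normcM normc_real gtr0_norm //.
set W := `|\sum_j w j|; set V := \sum_j `|w j|.
have V0 : 0 <= V by rewrite sumr_ge0.
have normcD l l' : normc (\sum_j ((w j)%:C)%C * D l l' j) <= V.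
  rewrite (le_trans (normc_sum _ _ _)) // ler_sum // => j _.
  by rewrite normcM normc_real normc_expi mulr1.
have diag l : normc ((\sum_(m < M) A l l m) * (\sum_j ((w j)%:C)%C * D l l j))
    <= M%:R * W.
  rewrite normcM ler_pM ?normc_ge0 //.
    rewrite (le_trans (normc_sum _ _ _)) // (eq_bigr (fun=> 1)) => [|m _].
      by rewrite sumr_const card_ord.
    by rewrite normc_expi.
  rewrite (eq_bigr (fun j => ((w j)%:C)%C)) => [|j _].
    by rewrite -rmorph_sum normc_real.
  by rewrite /D /dot3 !subrr !mul0r !addr0 expi0 mulr1.
have offdiag (l l' : grid K) : l' != l ->
    normc ((\sum_(m < M) A l l' m) * (\sum_j ((w j)%:C)%C * D l l' j)) <= B * V.
  move=> ll'; rewrite normcM ler_pM ?normc_ge0 //.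
  have := hB (l.1.1%:Z - l'.1.1%:Z) (l.1.2%:Z - l'.1.2%:Z) (l.2%:Z - l'.2%:Z).
  rewrite /A !intrB -!pmulrn; apply; rewrite ?absz_subn_lt //.
  apply: contraNT ll'; rewrite !negb_or !negbK !subr_eq0 !eqz_nat => /and3P[].
  case: l l' => [[a b] c] [[a' b'] c'] /= /eqP /val_inj -> /eqP /val_inj ->.
  by move=> /eqP /val_inj ->.
have row l : \sum_l' normc ((\sum_(m < M) A l l' m) *
    (\sum_j ((w j)%:C)%C * D l l' j)) <= M%:R * W + K%:R ^+ 3 * (B * V).
  rewrite (bigD1 l) //= lerD //.
  apply: (@le_trans _ _ (\sum_(l' : grid K) B * V)); last first.
    by rewrite sumr_const card_grid -[leLHS]mulr_natl natrX.
  rewrite [leRHS](bigD1 l) //= -[leLHS]add0r lerD ?mulr_ge0 //.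
  by apply: ler_sum => l' ll'; exact: offdiag.
(* There are [K ^ 3] diagonal pairs and fewer than [K ^ 6] others, against the factor [K ^- 6]. *)
apply: (@le_trans _ _ (K%:R ^- 6 * (K%:R ^+ 3 * (M%:R * W + K%:R ^+ 3 * (B * V))))).
  rewrite ler_pM2l // (le_trans (normc_sum _ _ _)) //.
  apply: (@le_trans _ _ (\sum_(l : grid K) (M%:R * W + K%:R ^+ 3 * (B * V)))).
    by apply: ler_sum => l _; rewrite (le_trans (normc_sum _ _ _)).
  by rewrite sumr_const card_grid -[leLHS]mulr_natl natrX.
by rewrite le_eqVlt; apply/orP; left; apply/eqP; field; rewrite gt_eqF.
Qed.

Definition near_mod1 (x y r : R) : Prop := exists k : int, `|x - y - k%:~R| < r.

(* The value of a function that is locally constant near the good grid points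
   is replaced by its average against the partition of unity [fejer3]. *)
Lemma sum_locally_constant_le K M (G : nat -> R) (g : grid K -> R)
    (bad : pred (grid K)) (x1 x2 x3 : nat -> R) (rho B : R) :
  (0 < K)%N -> 0 < rho -> 0 <= B ->
  (forall m, `|G m| <= 1) -> (forall j, `|g j| <= 1) -> \sum_j g j = 0 ->
  (forall m j, ~~ bad j -> near_mod1 (x1 m) ((j.1.1)%:R / K%:R) rho ->
     near_mod1 (x2 m) ((j.1.2)%:R / K%:R) rho ->
     near_mod1 (x3 m) ((j.2)%:R / K%:R) rho -> G m = g j) ->
  (forall h1 h2 h3 : int, [|| h1 != 0, h2 != 0 | h3 != 0] ->
    (`|h1| < K)%N -> (`|h2| < K)%N -> (`|h3| < K)%N ->
    normc (\sum_(m < M) expi (dot3 h1%:~R h2%:~R h3%:~R (x1 m) (x2 m) (x3 m))) <= B) ->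
  `|\sum_(m < M) G m| <= 6 * M%:R / (K%:R * rho ^+ 2) +
    2 * M%:R * (#|bad|%:R / K%:R ^+ 3) + 3 * K%:R ^+ 3 * B.
Proof.
move=> K0 rho0 B0 G1 g1 g0 Gg hB; have KR : 0 < K%:R :> R by rewrite ltr0n.
pose t : R := (K%:R * rho) ^- 2.
have t0 : 0 <= t by rewrite invr_ge0 exprn_ge0 // mulr_ge0 // ltW.
pose F x (i : 'I_K) := fejer K (x - i%:R / K%:R).
have F0 x i : 0 <= F x i by exact: fejer_ge0.
have Ft x (i : 'I_K) : ~ near_mod1 x (i%:R / K%:R) rho -> F x i <= t.
  move=> far; apply: fejer_le => // k; rewrite leNgt; apply/negP => h.
  by apply: far; exists k.
(* At a good grid point that is near in all three coordinates the difference vanishes. Otherwise a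
   far coordinate has kernel at most [t]; bad points are charged in full. *)
have pw m j : `|G m - g j| * fejer3 j (x1 m) (x2 m) (x3 m) <=
    2 * (t * F (x2 m) j.1.2 * F (x3 m) j.2 + F (x1 m) j.1.1 * t * F (x3 m) j.2
      + F (x1 m) j.1.1 * F (x2 m) j.1.2 * t)
    + 2 * ((bad j)%:R * fejer3 j (x1 m) (x2 m) (x3 m)).
  have d2 : `|G m - g j| <= 2.
    by rewrite (le_trans (ler_normB _ _)) // -[2]/(1 + 1) lerD.
  rewrite /fejer3 -/(F (x1 m) _) -/(F (x2 m) _) -/(F (x3 m) _).
  set a := F (x1 m) _; set b := F (x2 m) _; set c := F (x3 m) _.
  have [a0 b0 c0] : [/\ 0 <= a, 0 <= b & 0 <= c] by rewrite /a /b /c.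
  have ab := mulr_ge0 a0 b0; have ac := mulr_ge0 a0 c0; have bc := mulr_ge0 b0 c0.
  have abc := mulr_ge0 ab c0.
  have tb := mulr_ge0 t0 bc; have ta := mulr_ge0 t0 ac; have tc := mulr_ge0 t0 ab.
  have h2 : `|G m - g j| * (a * b * c) <= 2 * (a * b * c) by rewrite ler_wpM2r.
  have [bj|bj] := boolP (bad j); first by rewrite mul1r; lra.
  rewrite mul0r mulr0 addr0.
  have [n1|n1] := pselect (near_mod1 (x1 m) ((j.1.1)%:R / K%:R) rho); last first.
    have : a * (b * c) <= t * (b * c) by rewrite ler_wpM2r // Ft.
    lra.
  have [n2|n2] := pselect (near_mod1 (x2 m) ((j.1.2)%:R / K%:R) rho); last first.
    have : b * (a * c) <= t * (a * c) by rewrite ler_wpM2r // Ft.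
    lra.
  have [n3|n3] := pselect (near_mod1 (x3 m) ((j.2)%:R / K%:R) rho); last first.
    have : c * (a * b) <= t * (a * b) by rewrite ler_wpM2r // Ft.
    lra.
  by rewrite (Gg m j) // subrr normr0 mul0r; lra.
have sumF x : \sum_i F x i = 1 by exact: sum_fejer_translates.
have sumt : \sum_(i < K) t = K%:R * t by rewrite sumr_const card_ord mulr_natl.
(* In each of the three terms the two kernels sum to 1 and the constant [t] to [K t]. *)
have err m : `|G m - \sum_j g j * fejer3 j (x1 m) (x2 m) (x3 m)| <=
    6 * (K%:R * t) + 2 * \sum_j (bad j)%:R * fejer3 j (x1 m) (x2 m) (x3 m).
  have -> : G m - \sum_j g j * fejer3 j (x1 m) (x2 m) (x3 m) =
      \sum_j (G m - g j) * fejer3 j (x1 m) (x2 m) (x3 m).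
    rewrite (eq_bigr _ (fun j _ => mulrBl _ _ _)) sumrB -mulr_sumr.
    by rewrite sum_fejer3 // mulr1.
  rewrite (le_trans (ler_norm_sum _ _ _)) //.
  under eq_bigr => j _ do rewrite normrM [X in _ * X]ger0_norm ?fejer3_ge0 //.
  rewrite (le_trans (ler_sum _ (fun j _ => pw m j))) // big_split /= -!mulr_sumr.
  rewrite lerD2r !big_split /=.
  rewrite (big_triple (fun=> t)) (big_triple _ (fun=> t)) (big_triple _ _ (fun=> t)).
  by rewrite !sumF sumt; lra.
have mainw w := @weighted_fejer_sum_le K M w x1 x2 x3 B K0 B0 hB.
have h1 := mainw g; rewrite g0 normr0 mulr0 add0r in h1.
(* With the indicator of [bad] as weight, the same bound controls the kernel mass carried by the bad
   points. *)
have h2 := mainw (fun j => (bad j)%:R).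
have cb : \sum_j ((bad j)%:R : R) = #|bad|%:R.
  rewrite -natr_sum; congr _%:R; rewrite -sum1_card [RHS]big_mkcond /=.
  by apply: eq_bigr => j _; rewrite unfold_in; case: (bad j).
have cb' : \sum_j `|(bad j)%:R : R| = #|bad|%:R.
  by rewrite -cb; apply: eq_bigr => j _; rewrite normr_nat.
rewrite cb cb' normr_nat in h2.
have nb : #|bad|%:R <= K%:R ^+ 3 :> R by rewrite -natrX -card_grid ler_nat max_card.
have hg : \sum_j `|g j| <= K%:R ^+ 3.
  rewrite -natrX -card_grid -sumr_const; exact: ler_sum.
have h3 : `|\sum_(m < M) G m - \sum_(m < M) \sum_j g j * fejer3 j (x1 m) (x2 m) (x3 m)|
   <= \sum_(m < M) (6 * (K%:R * t) + 2 * \sum_j (bad j)%:R * fejer3 j (x1 m) (x2 m) (x3 m)).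
  rewrite -sumrB (le_trans (ler_norm_sum _ _ _)) //; exact: ler_sum.
have h4 : \sum_(m < M) (6 * (K%:R * t) + 2 * \sum_j (bad j)%:R * fejer3 j (x1 m) (x2 m) (x3 m))
   <= 6 * M%:R / (K%:R * rho ^+ 2) + 2 * (M%:R / K%:R ^+ 3 * #|bad|%:R + #|bad|%:R * B).
  rewrite big_split /= sumr_const card_ord -mulr_sumr lerD //.
    rewrite -[leLHS]mulr_natl le_eqVlt; apply/orP; left; apply/eqP.
    by rewrite /t; field; rewrite !gt_eqF.
  by rewrite ler_pM2l // (le_trans (ler_norm _)).
have h5 := le_trans h3 h4.
have h6 : (\sum_j `|g j|) * B <= K%:R ^+ 3 * B by rewrite ler_wpM2r.
have h7 : #|bad|%:R * B <= K%:R ^+ 3 * B by rewrite ler_wpM2r.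
set S := \sum_(m < M) G m in h5 *; set S' := \sum_(m < M) _ in h1 h5.
have h8 : `|S| <= `|S - S'| + `|S'| by rewrite -{1}(subrK S' S) ler_normD.
have h9 := le_trans h1 h6; rewrite mulrAC -mulrA in h5; lra.
Qed.
End Fejer.

(** * Nested floors as a function on the torus *)

Section NestedFloor.

Variable R : realType.
Implicit Types (x y u v r : R).

(** Both sides are the sum of [g] over [[0, K + s)] minus its sums over [[0, K)] and [[0, s)]. *)
Lemma sum_shiftB (V : zmodType) (g : nat -> V) (K s : nat) :
  \sum_(j < K) (g (j + s)%N - g j) = \sum_(i < s) (g (i + K)%N - g i).
Proof.
elim: s => [|s IHs].
  by rewrite big_ord0 big1 // => j _; rewrite addn0 subrr.
have E : g (s + K)%N - g s = \sum_(j < K) (g (s + j.+1)%N - g (s + j)%N).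
  rewrite -(big_mkord xpredT (fun j => g (s + j.+1)%N - g (s + j)%N)).
  by rewrite (telescope_sumr (fun j => g (s + j)%N)) // addn0.
rewrite big_ord_recr /= -IHs addrC E -big_split /=.
by apply: eq_bigr => j _; rewrite !addnS [(s + j)%N]addnC addrA subrK.
Qed.

(* The integer points of [(u_j - 2 r, u_j)], [u_j = q j / K - c + r], are
   counted by increments of the floor function, which telescope since
   [u_(j + K) = u_j + q]. *)
Lemma card_near_mod1_le (K q : nat) (c r : R) : (0 < K)%N -> (0 < q)%N -> 0 < r ->
  (\sum_(j < K) `[< near_mod1 (q%:R * (j%:R / K%:R)) c r >])%:R
    <= 2 * r * K%:R + q%:R :> R.
Proof.
move=> K0 q0 r0.
have KR : 0 < K%:R :> R by rewrite ltr0n.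
have qR : 0 < q%:R :> R by rewrite ltr0n.
have t0 : 0 <= 2 * r * K%:R / q%:R by rewrite divr_ge0 ?mulr_ge0 // ltW.
(* So many steps of length [q / K] exceed the width [2 r] of the window. *)
pose s := (Num.truncn (2 * r * K%:R / q%:R)).+1.
have /andP[s1 s2] := truncn_itv t0.
pose g (i : nat) : int := Num.floor ((i%:R - s%:R) * q%:R / K%:R - c + r).
have gK i : g (i + K)%N = g i + q%:Z.
  rewrite /g natrD -[q%:Z](@intrKfloor R) -floorDrz ?intr_int //; congr Num.floor.
  by rewrite -pmulrn; field; rewrite gt_eqF.
have gs (j : 'I_K) : (`[< near_mod1 (q%:R * (j%:R / K%:R)) c r >]%:Z <= g (j + s)%N - g j)%R.
  have gmono : g j <= Num.floor (q%:R * (j%:R / K%:R) - c - r).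
    apply: le_floor; rewrite -subr_ge0.
    have -> : q%:R * (j%:R / K%:R) - c - r - ((j%:R - s%:R) * q%:R / K%:R - c + r)
       = (s%:R - 2 * r * K%:R / q%:R) * (q%:R / K%:R) by field; rewrite !gt_eqF.
    by rewrite mulr_ge0 ?subr_ge0 ?ltW ?divr_gt0.
  have -> : g (j + s)%N = Num.floor (q%:R * (j%:R / K%:R) - c + r).
    by rewrite /g natrD addrK; congr Num.floor; ring.
  case: asboolP => [[k kr]|_] /=; last first.
    by rewrite subr_ge0 (le_trans gmono) // le_floor //; lra.
  have h1 : k <= Num.floor (q%:R * (j%:R / K%:R) - c + r).
    by rewrite floor_ge_int; move: kr; rewrite ltr_norml; lra.
  have h2 : g j < k.
    by rewrite (le_lt_trans gmono) // floor_lt_int; move: kr; rewrite ltr_norml; lra.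
  move: h1 h2; lia.
have : (\sum_(j < K) `[< near_mod1 (q%:R * (j%:R / K%:R)) c r >])%:Z <= s%:Z * q%:Z.
  rewrite -[leLHS]natz natr_sum.
  apply: (@le_trans _ _ (\sum_(j < K) (g (j + s)%N - g j))).
    by apply: ler_sum => j _; rewrite natz; exact: gs.
  rewrite sum_shiftB (eq_bigr (fun=> q%:Z)) => [|i _].
    by rewrite sumr_const card_ord -mulr_natl natz.
  by rewrite gK addrAC subrr add0r.
rewrite -(ler_int R) intrM -!pmulrn => /le_trans; apply.
have -> : s%:R = (Num.truncn (2 * r * K%:R / q%:R))%:R + 1 :> R by rewrite natr1.
by rewrite mulrDl mul1r lerD2r -ler_pdivlMr.
Qed.

Lemma floor_eq_near u v r : (forall k : int, r <= `|u - k%:~R|) ->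
  `|v - u| < r -> Num.floor v = Num.floor u.
Proof.
move=> far; rewrite ltr_norml => /andP[h1 h2]; apply: floor_def.
have /andP[f1 f2] := floor_itv u.
have := far (Num.floor u); rewrite ger0_norm ?subr_ge0 // => h3.
have h4 : r <= (Num.floor u + 1)%:~R - u.
  by have := far (Num.floor u + 1); rewrite ler0_norm ?opprB // subr_le0 ltW.
by apply/andP; split; lra.
Qed.

Definition frac x : R := x - (Num.floor x)%:~R.

Lemma frac_ge0_lt1 x : 0 <= frac x < 1.
Proof.
have /andP[h1 h2] := floor_itv x; rewrite intrD in h2.
by apply/andP; split; rewrite /frac; lra.
Qed.

Lemma frac_uniq x (k : int) v : 0 <= v < 1 -> x = k%:~R + v -> frac x = v.
Proof.
move=> /andP[v0 v1] ->; rewrite /frac (@floor_def _ _ k) ?intrD; first by ring.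
by apply/andP; split; lra.
Qed.

Lemma fracDz x (k : int) : frac (x + k%:~R) = frac x.
Proof.
apply: (@frac_uniq _ (Num.floor x + k)); first exact: frac_ge0_lt1.
by rewrite /frac intrD; ring.
Qed.

Lemma frac_near u v r (k : int) : (forall k : int, r <= `|u - k%:~R|) ->
  `|v - u - k%:~R| < r -> frac v = frac u + (v - u - k%:~R).
Proof.
move=> far h; rewrite -[in LHS](subrK k%:~R v) fracDz /frac.
by rewrite (floor_eq_near far (v := v - k%:~R)) 1?addrAC //; ring.
Qed.

Lemma chiE x : chi x = if frac x < 2^-1 then 1 else -1.
Proof. by []. Qed.

Lemma chiDz x (k : int) : chi (x + k%:~R) = chi x.
Proof. by rewrite !chiE fracDz. Qed.

Lemma norm_chi x : `|chi x| = 1.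
Proof. by rewrite chiE; case: ifP; rewrite ?normrN normr1. Qed.

(** The sign change behind the vanishing mean on even grids. Adding 1/2 carries into the next
    integer exactly when [frac x >= 1/2]. *)
Lemma chiD_half x : chi (x + 2^-1) = - chi x.
Proof.
have /andP[f0 f1] := frac_ge0_lt1 x.
have xE : x = (Num.floor x)%:~R + frac x by rewrite /frac addrC subrK.
rewrite !chiE; case: (ltP (frac x)) => h.
  rewrite (@frac_uniq (x + 2^-1) (Num.floor x) (frac x + 2^-1)).
  - by rewrite ltNge lerDr f0.
  - by apply/andP; split; lra.
  by rewrite addrA -xE.
rewrite (@frac_uniq (x + 2^-1) (Num.floor x + 1) (frac x - 2^-1)).
- by rewrite opprK; case: ltP => //; lra.
- by apply/andP; split; lra.
by rewrite intrD {1}xE; lra.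
Qed.

(** The jumps of [chi] lie at the multiples of 1/2, whence the hypothesis on [2 * u]. *)
Lemma chi_near u v r (k : int) : (forall k : int, 2 * r <= `|2 * u - k%:~R|) ->
  `|v - u - k%:~R| < r -> chi v = chi u.
Proof.
move=> far h; rewrite -[in LHS](subrK k%:~R v) chiDz; set w := v - k%:~R.
(* [chi z] is determined by the parity of [floor (2 z)]. *)
have floor2 z : Num.floor (2 * z) = 2 * Num.floor z + (frac z < 2^-1 == false)%:Z.
  have /andP[f0 f1] := frac_ge0_lt1 z; apply: floor_def.
  have zE : z = (Num.floor z)%:~R + frac z by rewrite /frac addrC subrK.
  rewrite !intrD intrM [in 2 * z]zE.
  by case: ltP => h'; rewrite /= ?mulr0z ?mulr1z; lra.
have : Num.floor (2 * w) = Num.floor (2 * u).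
  apply: (floor_eq_near far).
  by rewrite -mulrBr normrM ger0_norm // ltr_pM2l // /w addrAC.
rewrite !floor2 !chiE; case: (frac w < _); case: (frac u < _) => //=; lia.
Qed.

(** The torus function [G] of the overview; it depends on [x1], [x2], [x3] only modulo 1. *)
Definition floor_phase (alpha beta x1 x2 x3 : R) : R :=
  chi (x3 - beta * alpha * frac x1 - beta * frac (x2 - alpha * frac x1)).

Lemma chi_nested_floor (alpha1 alpha2 beta : R) (p : {poly R}) x :
  chi (nested_floor alpha1 alpha2 beta p x) =
  floor_phase alpha1 beta (alpha2 * p.[x]) (alpha1 * alpha2 * p.[x])
    (alpha1 * alpha2 * beta * p.[x]).
Proof.
rewrite /floor_phase /nested_floor; congr chi.
have -> : alpha1 * alpha2 * p.[x] - alpha1 * frac (alpha2 * p.[x]) =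
    alpha1 * (Num.floor (alpha2 * p.[x]))%:~R by rewrite /frac; ring.
rewrite [in RHS]/frac; ring.
Qed.

(** One alternative for each source of jumps: the first [frac], the second [frac], and [chi]. The
    radii allow for the propagated perturbations; the last condition is doubled because [chi] jumps
    at multiples of 1/2. *)
Definition bad_phase (alpha beta rho y1 y2 y3 : R) : Prop :=
  [\/ near_mod1 y1 0 rho,
      near_mod1 y2 (alpha * frac y1) (rho * (1 + `|alpha|)) |
      near_mod1 (2 * y3)
        (2 * (beta * alpha * frac y1 + beta * frac (y2 - alpha * frac y1)))
        (2 * (rho * (1 + `|beta|)))].

Lemma floor_phase_near (alpha beta rho x1 x2 x3 y1 y2 y3 : R) :
  ~ bad_phase alpha beta rho y1 y2 y3 ->
  near_mod1 x1 y1 rho -> near_mod1 x2 y2 rho -> near_mod1 x3 y3 rho ->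
  floor_phase alpha beta x1 x2 x3 = floor_phase alpha beta y1 y2 y3.
Proof.
move=> good [k1 h1] [k2 h2] [k3 h3].
have far1 (k : int) : rho <= `|y1 - k%:~R|.
  rewrite leNgt; apply/negP => h; apply: good; constructor 1.
  by exists k; rewrite subr0.
have far2 (k : int) : rho * (1 + `|alpha|) <= `|y2 - alpha * frac y1 - k%:~R|.
  rewrite leNgt; apply/negP => h; apply: good; constructor 2.
  by exists k.
have e1 := frac_near far1 h1.
set d1 := x1 - y1 - k1%:~R in h1 e1; set d2 := x2 - y2 - k2%:~R in h2.
have E2 : x2 - alpha * frac x1 - (y2 - alpha * frac y1) - k2%:~R = d2 - alpha * d1.
  by rewrite e1 /d2; ring.
have e2 := frac_near (v := x2 - alpha * frac x1) (k := k2) far2.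
rewrite E2 in e2; move/(_ _) in e2.
have {}e2 : frac (x2 - alpha * frac x1) = frac (y2 - alpha * frac y1) + (d2 - alpha * d1).
  apply: e2; rewrite (le_lt_trans (ler_normB _ _)) // [ltRHS]mulrDr mulr1 ltr_leD //.
  by rewrite normrM mulrC ler_wpM2r // ltW.
apply: (@chi_near _ _ (rho * (1 + `|beta|)) k3).
  move=> k; rewrite leNgt; apply/negP => h; apply: good; constructor 3.
  exists k; apply: le_lt_trans h; rewrite le_eqVlt; apply/orP; left; apply/eqP.
  by congr `| _ |; ring.
(* The two contributions of [d1] cancel, so the third radius involves [beta] but not [alpha]. *)
have -> : x3 - beta * alpha * frac x1 - beta * frac (x2 - alpha * frac x1) -
    (y3 - beta * alpha * frac y1 - beta * frac (y2 - alpha * frac y1)) - k3%:~R =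
    (x3 - y3 - k3%:~R) - beta * d2 by rewrite e2 e1; ring.
rewrite (le_lt_trans (ler_normB _ _)) // [ltRHS]mulrDr mulr1 ltr_leD //.
by rewrite normrM mulrC ler_wpM2r // ltW.
Qed.

Lemma sum_grid (V : nmodType) K (F : grid K -> V) :
  \sum_j F j = \sum_a \sum_b \sum_c F (a, b, c).
Proof.
rewrite (pair_bigA _ (fun a b => \sum_c F (a, b, c))) /=.
rewrite (pair_bigA _ (fun ab c => F (ab.1, ab.2, c))) /=.
by apply: eq_bigr => [[[a b] c]].
Qed.

(** The indices [c] and [L + c] differ by 1/2 in the third coordinate, so their values cancel. *)
Lemma sum_floor_phase_grid (alpha beta : R) (L : nat) : (0 < L)%N ->
  let K := (L + L)%N in
  \sum_(j : grid K) floor_phase alpha beta ((j.1.1)%:R / K%:R)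
    ((j.1.2)%:R / K%:R) ((j.2)%:R / K%:R) = 0.
Proof.
move=> L0 K; rewrite sum_grid big1 // => a _; rewrite big1 // => b _ /=.
rewrite big_split_ord /= -big_split big1 //= => c _.
have -> : ((L + c)%N)%:R / K%:R = c%:R / K%:R + 2^-1 :> R.
  by rewrite /K !natrD; field; rewrite -mulr2n mulrn_eq0 /= pnatr_eq0 -lt0n.
rewrite /floor_phase.
set A := beta * alpha * _; set A' := beta * frac _.
rewrite (_ : c%:R / K%:R + 2^-1 - A - A' = c%:R / K%:R - A - A' + 2^-1).
  by rewrite chiD_half subrr.
by ring.
Qed.

(** Each alternative restricts the last coordinate it involves once the earlier ones are fixed. The
    counts use [q = 1, 1, 2], whose sum is the 4 in [4 / K]. *)
Lemma card_bad_phase_le (alpha beta rho : R) (K : nat) : (0 < K)%N -> 0 < rho ->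
  #|[pred j : grid K | `[< bad_phase alpha beta rho ((j.1.1)%:R / K%:R)
      ((j.1.2)%:R / K%:R) ((j.2)%:R / K%:R) >]]|%:R <=
  K%:R ^+ 3 * ((8 + 2 * `|alpha| + 4 * `|beta|) * rho + 4 / K%:R) :> R.
Proof.
move=> K0 r0; have KR : 0 < K%:R :> R by rewrite ltr0n.
pose y (a : 'I_K) : R := a%:R / K%:R.
pose P1 a := `[< near_mod1 (1%:R * y a) 0 rho >].
pose P2 a b := `[< near_mod1 (1%:R * y b) (alpha * frac (y a)) (rho * (1 + `|alpha|)) >].
pose P3 a b c := `[< near_mod1 (2%:R * y c)
  (2 * (beta * alpha * frac (y a) + beta * frac (y b - alpha * frac (y a))))
  (2 * (rho * (1 + `|beta|))) >].
have c1 : (\sum_a P1 a)%:R <= 2 * rho * K%:R + 1 :> R by exact: card_near_mod1_le.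
have ra : 0 < rho * (1 + `|alpha|) by rewrite mulr_gt0 // ltr_pwDl.
have rb : 0 < 2 * (rho * (1 + `|beta|)) by rewrite !mulr_gt0 // ltr_pwDl.
have c2 a : (\sum_b P2 a b)%:R <= 2 * (rho * (1 + `|alpha|)) * K%:R + 1 :> R.
  exact: card_near_mod1_le.
have c3 a b : (\sum_c P3 a b c)%:R <= 2 * (2 * (rho * (1 + `|beta|))) * K%:R + 2 :> R.
  exact: card_near_mod1_le.
apply: (@le_trans _ _ (\sum_(j : grid K)
    ((P1 j.1.1)%:R + (P2 j.1.1 j.1.2)%:R + (P3 j.1.1 j.1.2 j.2)%:R))).
  rewrite -sum1_card natr_sum [leLHS]big_mkcond /=; apply: ler_sum => j _.
  case: ifP => [|_]; last by rewrite !addr_ge0.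
  rewrite unfold_in => /asboolP bad; rewrite -!natrD ler1n /P1 /P2 /P3 !mul1r.
  by rewrite !addn_gt0; case: bad => [/asboolP ->|/asboolP ->|/asboolP ->]; rewrite ?orbT.
rewrite sum_grid.
have KK : \sum_(a < K) \sum_(b < K) (1 : R) = K%:R ^+ 2.
  by rewrite !sumr_const !card_ord -mulrnA mulnn natrX.
apply: (@le_trans _ _ (K%:R ^+ 2 * (2 * rho * K%:R + 1) +
   K%:R ^+ 2 * (2 * (rho * (1 + `|alpha|)) * K%:R + 1) +
   K%:R ^+ 2 * (2 * (2 * (rho * (1 + `|beta|))) * K%:R + 2))); last first.
  by rewrite le_eqVlt; apply/orP; left; apply/eqP; field; rewrite gt_eqF.
under eq_bigr => a _ do under eq_bigr => b _ do rewrite !big_split /=.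
under eq_bigr => a _ do rewrite !big_split /=.
rewrite !big_split /=.
rewrite lerD ?lerD //.
- under eq_bigr => a _ do rewrite !sumr_const !card_ord -mulrnA mulnn.
  by rewrite sumrMnl -natr_sum -[leLHS]mulr_natl natrX ler_wpM2l // exprn_ge0 // ltW.
- apply: (@le_trans _ _ (\sum_(a < K) K%:R * (2 * (rho * (1 + `|alpha|)) * K%:R + 1))).
    apply: ler_sum => a _; under eq_bigr => b _ do rewrite sumr_const card_ord.
    by rewrite sumrMnl -natr_sum -[leLHS]mulr_natl ler_wpM2l // ltW.
  by rewrite sumr_const card_ord -[leLHS]mulr_natl mulrA -expr2.
- rewrite -KK mulr_suml; apply: ler_sum => a _; rewrite mulr_suml; apply: ler_sum => b _.
  by rewrite mul1r -natr_sum.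
Qed.

Lemma sum_floor_phase_le (alpha beta rho B : R) (L M : nat) (x1 x2 x3 : nat -> R) :
  (0 < L)%N -> 0 < rho -> 0 <= B ->
  let K := (L + L)%N in
  (forall h1 h2 h3 : int, [|| h1 != 0, h2 != 0 | h3 != 0] ->
    (`|h1| < K)%N -> (`|h2| < K)%N -> (`|h3| < K)%N ->
    normc (\sum_(m < M) expi (dot3 h1%:~R h2%:~R h3%:~R (x1 m) (x2 m) (x3 m))) <= B) ->
  `|\sum_(m < M) floor_phase alpha beta (x1 m) (x2 m) (x3 m)| <=
    6 * M%:R / (K%:R * rho ^+ 2) +
    2 * M%:R * ((8 + 2 * `|alpha| + 4 * `|beta|) * rho + 4 / K%:R) +
    3 * K%:R ^+ 3 * B.
Proof.
move=> L0 r0 B0 K hB; have K0 : (0 < K)%N by rewrite addn_gt0 L0.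
have KR : 0 < K%:R :> R by rewrite ltr0n.
pose bad : pred (grid K) := [pred j : grid K | `[< bad_phase alpha beta rho
  ((j.1.1)%:R / K%:R) ((j.1.2)%:R / K%:R) ((j.2)%:R / K%:R) >]].
pose G m := floor_phase alpha beta (x1 m) (x2 m) (x3 m).
pose g (j : grid K) := floor_phase alpha beta ((j.1.1)%:R / K%:R)
  ((j.1.2)%:R / K%:R) ((j.2)%:R / K%:R).
apply: le_trans (@sum_locally_constant_le R K M G g bad x1 x2 x3 rho B
  K0 r0 B0 _ _ _ _ hB) _.
- by move=> m; rewrite norm_chi.
- by move=> j; rewrite norm_chi.
- exact: sum_floor_phase_grid.
- by move=> m j /asboolPn good; exact: floor_phase_near.
rewrite lerD2r lerD2l ler_wpM2l ?mulr_ge0 //.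
by rewrite ler_pdivrMr ?exprn_gt0 // mulrC card_bad_phase_le.
Qed.

End NestedFloor.

(** * Finite type and the choice of parameters *)

Section FiniteType.

Variable R : realType.

Lemma dist_int_le (x : R) (k : int) : dist_int x <= `|x - k%:~R|.
Proof.
apply: ge_inf; last by exists k.
by exists 0 => _ [j _ <-].
Qed.

Lemma iter_sqrt_exp2 (k : nat) (x : R) : 0 <= x ->
  iter k Num.sqrt (x ^+ (2 ^ k)) = x.
Proof.
move=> x0; elim: k => [|k IHk]; first by rewrite expn0 expr1.
by rewrite iterSr expnSr exprM sqrtr_sqr ger0_norm ?exprn_ge0.
Qed.

(** Any polynomial lower bound will do, so [eps = 1] is taken and [t + 1] is rounded up to an
    integer [s]; each of the three factors is then at most [X ^ s]. *)
Lemma finite_type3_lower_bound (g1 g2 g3 t : R) :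
  finite_type (\row_(j < 3) [:: g1; g2; g3]`_j) t ->
  exists s : nat, exists2 c : R, 0 < c &
    forall (X : nat) (n1 n2 n3 : int), [|| n1 != 0, n2 != 0 | n3 != 0] ->
      (`|n1| <= X)%N -> (`|n2| <= X)%N -> (`|n3| <= X)%N ->
      forall k : int, c / X%:R ^+ (3 * s) <=
        `|n1%:~R * g1 + n2%:~R * g2 + n3%:~R * g3 - k%:~R|.
Proof.
move=> [t0 /(_ 1 ltr01) [c c0 hc]].
have t1 : 0 <= t + 1 by rewrite addr_ge0 // ltW.
pose s := (Num.truncn (t + 1)).+1.
exists s; exists c => // X n1 n2 n3 nz h1 h2 h3 k.
have ts : t + 1 <= s%:R by have /andP[_ /ltW] := truncn_itv t1.
pose n : 'rV[int]_3 := \row_(j < 3) [:: n1; n2; n3]`_j.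
have n0 : n != 0.
  apply: contraTneq nz => nE; rewrite !negb_or !negbK.
  have e j : n 0 j = 0 by rewrite nE mxE.
  have := e (@Ordinal 3 0 isT); have := e (@Ordinal 3 1 isT).
  by have := e (@Ordinal 3 2 isT); rewrite !mxE /= => -> -> ->; rewrite !eqxx.
have X0 : (0 < X)%N.
  by case/or3P: nz; rewrite -absz_gt0 => nz;
    [exact: leq_trans nz h1|exact: leq_trans nz h2|exact: leq_trans nz h3].
have XR : 1 <= X%:R :> R by rewrite ler1n.
have one (m : int) : (`|m| <= X)%N -> 0 <= Num.max 1 `|m%:~R : R| `^ (t + 1) <= X%:R ^+ s.
  move=> mX; rewrite powR_ge0 /= -powR_mulrn ?ler0n //.
  have mm : Num.max 1 `|m%:~R : R| <= X%:R.
    by rewrite ge_max XR -intr_norm -abszE -pmulrn ler_nat.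
  rewrite (@le_trans _ _ (X%:R `^ (t + 1))) //; last by rewrite ler_powR.
  by rewrite ge0_ler_powR ?nnegrE ?le_max ?ler01 ?ler0n.
have := hc n n0; rewrite !big_ord_recl !big_ord0 /= !mxE /= mulr1 addr0 => hcn.
rewrite ler_pdivrMr ?exprn_gt0 ?ltr0n // [leRHS]mulrC (le_trans hcn) //.
rewrite addrA; set z := _ + _ + _.
have z0 : 0 <= dist_int z.
  apply: lb_le_inf; first by exists `|z - 0%:~R|; exists 0.
  by move=> _ [j _ <-].
have /andP[p1 q1] := one _ h1; have /andP[p2 q2] := one _ h2.
have /andP[p3 q3] := one _ h3.
have -> : X%:R ^+ (3 * s) = X%:R ^+ s * (X%:R ^+ s * X%:R ^+ s) :> R.
  by rewrite mulnC exprM; ring.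
have pp := mulr_ge0 p2 p3.
exact: ler_pM (mulr_ge0 p1 pp) z0 (ler_pM p1 pp q1 (ler_pM p2 p3 q2 q3))
  (dist_int_le z k).
Qed.

End FiniteType.

(** * Weyl sums of the polynomial phases and sums along progressions *)

Section Assembly.

Variables (R : realType) (alpha1 alpha2 beta : R) (d : nat) (p : {poly R}).
Hypotheses (p_monic : p \is monic) (deg_p : size p = d.+2).

Let g1 := alpha2.
Let g2 := alpha1 * alpha2.
Let g3 := alpha1 * alpha2 * beta.

(* The grid has mesh [1 / K] with [K = 2 Y^3]; taking [H = Y^B] and
   [sigma = Y^(-B)] makes [iter d sqrt sigma = Y^(-10)], which outweighs the
   [K^3 = 8 Y^9] frequencies.  The multiples of the slope that occur have
   coefficients of size at most [d.+1! 2^(d + 2) Y^E]. *)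
Lemma weyl_polynomial_bound (s : nat) (c : R) (Y a M : nat) (b0 : R) (h1 h2 h3 : int) :
  0 < c ->
  (forall (X : nat) (n1 n2 n3 : int), [|| n1 != 0, n2 != 0 | n3 != 0] ->
      (`|n1| <= X)%N -> (`|n2| <= X)%N -> (`|n3| <= X)%N ->
      forall k : int, c / X%:R ^+ (3 * s) <=
        `|n1%:~R * g1 + n2%:~R * g2 + n3%:~R * g3 - k%:~R|) ->
  [|| h1 != 0, h2 != 0 | h3 != 0] ->
  (`|h1| < 2 * Y ^ 3)%N -> (`|h2| < 2 * Y ^ 3)%N -> (`|h3| < 2 * Y ^ 3)%N ->
  (0 < a <= 2 * Y)%N -> (0 < Y)%N ->
  (d.+1`! * 2 ^ d.+2)%:R ^+ (3 * s) <= c * Y%:R ->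
  let B := (10 * 2 ^ d)%N in let E := (B * d + d.+1 + 3)%N in
  (Y ^ (3 * s * E + 2 * B + 1) <= M)%N ->
  normc (\sum_(m < M) expi (dot3 h1%:~R h2%:~R h3%:~R
    (g1 * p.[a%:R * m%:R + b0]) (g2 * p.[a%:R * m%:R + b0])
    (g3 * p.[a%:R * m%:R + b0]))) <= 8 * M%:R * Y%:R ^- 10.
Proof.
move=> c0 hc nz hh1 hh2 hh3 /andP[a0 aY] Y0 hY B E hM.
have YR : 0 < Y%:R :> R by rewrite ltr0n.
have Y1 : 1 <= Y%:R :> R by rewrite ler1n.
have M0 : (0 < M)%N by rewrite (leq_trans _ hM) // expn_gt0 Y0.
have MR : 0 < M%:R :> R by rewrite ltr0n.
pose theta := h1%:~R * g1 + h2%:~R * g2 + h3%:~R * g3.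
pose f m := theta * p.[a%:R * m%:R + b0].
rewrite (eq_bigr (fun m : 'I_M => expi (f m))) => [|m _]; last first.
  by congr expi; rewrite /dot3 /f /theta; ring.
pose L := (d.+1)`!%:R * (theta * a%:R ^+ d.+1).
have hf : iter d.+1 (@fdiff R) f =1 (fun=> L).
  by apply: iter_fdiff_monic_comp_affine => //; rewrite pnatr_eq0 -lt0n.
pose sigma : R := Y%:R ^- B.
have sE : iter d Num.sqrt sigma = Y%:R ^- 10.
  rewrite /sigma /B exprM -exprVn -[in RHS]exprVn.
  by rewrite -exprVn iter_sqrt_exp2 // exprn_ge0 // invr_ge0 ltW.
have YB0 : 0 < Y%:R ^+ B :> R by rewrite exprn_gt0.
have s01 : 0 < sigma <= 1.
  by rewrite invr_gt0 YB0 invf_le1 // exprn_ege1.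
have hM' e : (e <= 3 * s * E + 2 * B + 1)%N -> Y%:R ^+ e <= M%:R :> R.
  move=> he; rewrite -natrX ler_nat (leq_trans _ hM) //.
  by rewrite leq_pexp2l.
rewrite -sE; apply: (@weyl_bound R d f L sigma M (Y ^ B)) => //.
- by rewrite expn_gt0 Y0.
- by rewrite natrX.
- by rewrite natrX /sigma mulrC ler_pdivlMr // -exprD hM' //; lia.
move=> q q0 hq j.
(* This dominates [q * d.+1! * a ^ d.+1 * h], by [|q| <= Y ^ (B * d)], [a <= 2 Y] and
   [|h| < 2 Y ^ 3]. *)
pose X := (d.+1`! * 2 ^ d.+2 * Y ^ E)%N.
pose r (h : int) : int := q * (d.+1`!)%:Z * a%:Z ^+ d.+1 * h.
have rX h : (`|h| < 2 * Y ^ 3)%N -> (`|r h| <= X)%N.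
  move=> /ltnW hh; rewrite /r !abszM abszX /=.
  have aD : (a ^ d.+1 <= 2 ^ d.+1 * Y ^ d.+1)%N by rewrite -expnMn leq_exp2r.
  rewrite -expnM in hq.
  apply: leq_trans (leq_mul (leq_mul (leq_mul hq (leqnn _)) aD) hh) _.
  rewrite /X /E (expnS 2 d.+1) !expnD; apply: eq_leq.
  by move: (Y ^ _)%N (Y ^ _)%N (Y ^ 3)%N (2 ^ _)%N (_`!)%N => *; ring.
have r0 h : h != 0 -> r h != 0.
  by move=> hn; rewrite /r !mulf_neq0 // ?expf_neq0 // ?eqz_nat -?lt0n ?fact_gt0.
have nz' : [|| r h1 != 0, r h2 != 0 | r h3 != 0].
  by case/or3P: nz => /r0 ->; rewrite ?orbT.
have := hc X _ _ _ nz' (rX _ hh1) (rX _ hh2) (rX _ hh3) j.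
have -> : (r h1)%:~R * g1 + (r h2)%:~R * g2 + (r h3)%:~R * g3 = q%:~R * L.
  by rewrite /r /L /theta !intrM rmorphXn /= -!pmulrn; ring.
apply: le_trans.
have X0 : 0 < X%:R :> R by rewrite ltr0n /X 2!muln_gt0 fact_gt0 !expn_gt0 Y0.
(* What remains is [Y ^ B * X ^ (3 s) <= c M]; the constant factor of [X ^ (3 s)] is at most [c Y],
   which costs one more power of [Y]. *)
rewrite /sigma invfM invrK ler_pdivrMr // [leRHS]mulrAC ler_pdivlMr ?exprn_gt0 //.
rewrite /X natrM exprMn [(Y ^ E)%:R]natrX -exprM.
apply: (@le_trans _ _ (Y%:R ^+ B * (c * Y%:R * Y%:R ^+ (E * (3 * s))))).
  by rewrite ler_pM2l // ler_pM2r ?exprn_gt0.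
rewrite (_ : _ * _ = c * Y%:R ^+ (B + 1 + E * (3 * s))); last first.
  by rewrite !exprD expr1; ring.
by rewrite ler_pM2l // hM' //; lia.
Qed.

(** Reindexing from 0 replaces the shift [b] by [a + b]; as this is at least 1, all arguments are
    positive and [absz] changes nothing. *)
Lemma sum_chi_progressionE (a M : nat) (b : int) : 1 <= a%:Z + b ->
  \sum_(1 <= m < M.+1) chi (nested_floor alpha1 alpha2 beta p
      (absz (a%:Z * m%:Z + b))%:R) =
  \sum_(m < M) floor_phase alpha1 beta
     (g1 * p.[a%:R * m%:R + (a%:Z + b)%:~R])
     (g2 * p.[a%:R * m%:R + (a%:Z + b)%:~R])
     (g3 * p.[a%:R * m%:R + (a%:Z + b)%:~R]).
Proof.
move=> ab; rewrite big_add1 big_mkord; apply: eq_bigr => m _.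
rewrite chi_nested_floor; congr (floor_phase _ _ (_ * p.[_]) (_ * p.[_]) (_ * p.[_]));
  rewrite natr_absz ger0_norm ?intrD ?intrM -?pmulrn -?natr1; do ?ring; nia.
Qed.

Lemma norm_sum_floor_phase_le_size (M : nat) (x1 x2 x3 : nat -> R) :
  `|\sum_(m < M) floor_phase alpha1 beta (x1 m) (x2 m) (x3 m)| <= M%:R.
Proof.
rewrite (le_trans (ler_norm_sum _ _ _)) // (eq_bigr (fun=> 1)) => [|m _].
  by rewrite sumr_const card_ord.
by rewrite norm_chi.
Qed.

(** The strict inequality forces [M >= 2]. As [b] may be negative, the hypotheses give
    [a (M - 1) < N], and the remaining [a] costs the factor 2. *)
Lemma progression_bounds (N a M : nat) (b : int) :
  (0 < a)%N -> 1 <= a%:Z + b -> a%:Z + b < a%:Z * M%:Z + b <= N%:Z ->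
  (M <= N)%N /\ (a * M <= 2 * N)%N.
Proof.
move=> a0 ab /andP[]; rewrite ltrD2r.
case: M => [|[|M]]; rewrite ?muln1; first by lia.
  by rewrite mulr1 ltxx.
move=> _ MN; have aM : (a * M.+1 < N)%N by lia.
have h1 : (M.+1 <= a * M.+1)%N by rewrite leq_pmull.
have h2 : (a <= a * M.+1)%N by rewrite leq_pmulr.
by split; [|rewrite mulnS]; lia.
Qed.

Lemma progression_sum_le (t : R) :
  finite_type (\row_(j < 3) [:: g1; g2; g3]`_j) t ->
  exists2 P : nat, (0 < P)%N & exists2 C : R, 0 < C &
    forall (N Y a M : nat) (b : int), (0 < Y)%N -> (Y ^ P <= N)%N ->
      (0 < a)%N -> 1 <= a%:Z + b -> a%:Z + b < a%:Z * M%:Z + b <= N%:Z ->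
      `|\sum_(1 <= m < M.+1) chi (nested_floor alpha1 alpha2 beta p
          (absz (a%:Z * m%:Z + b))%:R)| <= C * (N%:R / Y%:R).
Proof.
move=> /finite_type3_lower_bound[s [c c0 hc]].
pose B := (10 * 2 ^ d)%N; pose E := (B * d + d.+1 + 3)%N.
pose C2 : R := (d.+1`! * 2 ^ d.+2)%:R ^+ (3 * s).
pose C1 : R := 8 + 2 * `|alpha1| + 4 * `|beta|.
have C20 : 0 <= C2 by rewrite exprn_ge0.
have C10 : 0 <= C1 by rewrite !addr_ge0 // mulr_ge0.
have C2c : 0 <= C2 / c by rewrite divr_ge0 // ltW.
(* The successor makes up for the factor [Y] lost in passing from [N] to [M > N / Y]. *)
exists (3 * s * E + 2 * B + 1).+1 => //.
exists (C2 / c + 203 + 2 * C1); first by lra.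
move=> N Y a M b Y0 YN a0 ab abM.
have [MN aMN] := progression_bounds a0 ab abM.
have YR : 0 < Y%:R :> R by rewrite ltr0n.
have Y1 : 1 <= Y%:R :> R by rewrite ler1n.
have NY0 : 0 <= N%:R / Y%:R :> R by rewrite divr_ge0.
rewrite sum_chi_progressionE //; set b0 : R := _%:~R.
have triv := norm_sum_floor_phase_le_size M (fun m => g1 * p.[a%:R * m%:R + b0])
  (fun m => g2 * p.[a%:R * m%:R + b0]) (fun m => g3 * p.[a%:R * m%:R + b0]).
(* For small [Y] the constant absorbs the trivial bound; otherwise [C2 <= c Y]. *)
have [YC|YC] := leP Y%:R (C2 / c).
  rewrite (le_trans triv) //.
  have : N%:R <= C2 / c * (N%:R / Y%:R).
    by rewrite mulrCA ler_peMr // ler_pdivlMr // mul1r.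
  have : M%:R <= N%:R :> R by rewrite ler_nat.
  have : 0 <= (203 + 2 * C1) * (N%:R / Y%:R) by rewrite mulr_ge0 //; lra.
  lra.
have [MY|MY] := leqP (M * Y) N.
  rewrite (le_trans triv) //.
  have : M%:R <= N%:R / Y%:R :> R by rewrite ler_pdivlMr // -natrM ler_nat.
  have : 0 <= (C2 / c + 202 + 2 * C1) * (N%:R / Y%:R) by rewrite mulr_ge0 //; lra.
  lra.
(* Here [N < M Y] and [a M <= 2 N], which bounds the step. *)
have aY : (0 < a <= 2 * Y)%N by rewrite a0 /=; nia.
have hM : (Y ^ (3 * s * E + 2 * B + 1) <= M)%N.
  by rewrite -(leq_pmul2r Y0) -expnSr (leq_trans YN) // ltnW.
have hY : C2 <= c * Y%:R by rewrite mulrC -ler_pdivrMr // ltW.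
have L0 : (0 < Y ^ 3)%N by rewrite expn_gt0 Y0.
have r0 : 0 < Y%:R^-1 :> R by rewrite invr_gt0.
have B0 : 0 <= 8 * M%:R * Y%:R ^- 10 :> R by rewrite mulr_ge0 ?invr_ge0 ?exprn_ge0.
(* With [rho = 1 / Y] and [K = 2 Y ^ 3], the kernel tails give [3 M / Y], the bad points a constant
   times [M / Y], and the frequencies [192 M / Y]. *)
have := @sum_floor_phase_le R alpha1 beta Y%:R^-1 (8 * M%:R * Y%:R ^- 10) (Y ^ 3) M
  (fun m => g1 * p.[a%:R * m%:R + b0]) (fun m => g2 * p.[a%:R * m%:R + b0])
  (fun m => g3 * p.[a%:R * m%:R + b0]) L0 r0 B0.
rewrite addnn -mul2n => /(_ _)/le_trans; apply.
  move=> h1 h2 h3 nz hh1 hh2 hh3.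
  exact: (weyl_polynomial_bound b0 c0 hc nz hh1 hh2 hh3 aY Y0 hY hM).
rewrite -/C1 natrM natrX.
have MN' : M%:R / Y%:R <= N%:R / Y%:R :> R.
  by rewrite ler_pM2r ?invr_gt0 // ler_nat.
have MY0 : 0 <= M%:R / Y%:R :> R by rewrite divr_ge0.
have -> : 6 * M%:R / (2 * Y%:R ^+ 3 * Y%:R^-1 ^+ 2) = 3 * (M%:R / Y%:R) :> R.
  by field; rewrite gt_eqF.
have -> : 3 * (2 * Y%:R ^+ 3) ^+ 3 * (8 * M%:R * Y%:R ^- 10) = 192 * (M%:R / Y%:R) :> R.
  by field; rewrite gt_eqF.
have -> : 2 * M%:R * (C1 * Y%:R^-1 + 4 / (2 * Y%:R ^+ 3)) =
    2 * C1 * (M%:R / Y%:R) + 4 * (M%:R / Y%:R * Y%:R ^- 2) :> R.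
  by field; rewrite gt_eqF.
have h1 : M%:R / Y%:R * Y%:R ^- 2 <= M%:R / Y%:R :> R.
  by rewrite ler_piMr // invf_le1 ?exprn_gt0 // exprn_ege1.
have h2 : (203 + 2 * C1) * (M%:R / Y%:R) <= (203 + 2 * C1) * (N%:R / Y%:R).
  by rewrite ler_wpM2l //; lra.
have h3 : 0 <= C2 / c * (N%:R / Y%:R) by rewrite mulr_ge0.
lra.
Qed.

End Assembly.

(** * Choice of the parameter [Y] and conclusion *)

Lemma exists_nat_root (R : realType) (P N : nat) : (0 < P)%N -> (0 < N)%N ->
  exists2 Y : nat, (0 < Y)%N && (Y ^ P <= N)%N &
    N%:R / Y%:R <= 2 * N%:R `^ (1 - P%:R^-1) :> R.
Proof.
move=> P0 N0; have NR : 0 < N%:R :> R by rewrite ltr0n.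
set z : R := N%:R `^ P%:R^-1.
have z0 : 0 <= z by exact: powR_ge0.
have z1 : 1 <= z.
  by rewrite -(powRr0 N%:R) ler_powR ?ler1n // invr_ge0.
(* Rounding [z >= 1] down loses at most a factor 2. *)
exists (Num.truncn z).
  have Y0 : (0 < Num.truncn z)%N by rewrite truncn_ge_nat.
  have /andP[Yz _] := truncn_itv z0.
  rewrite Y0 -(ler_nat R) natrX.
  have -> : N%:R = z ^+ P :> R.
    by rewrite -powR_mulrn // -powRrM mulVf ?pnatr_eq0 -?lt0n // powRr1.
  by rewrite lerXn2r ?nnegrE.
have /andP[_ zY] := truncn_itv z0.
have Y1 : (1 <= Num.truncn z)%N by rewrite truncn_ge_nat.
have Y1R : 1 <= (Num.truncn z)%:R :> R by rewrite ler1n.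
have -> : N%:R `^ (1 - P%:R^-1) = N%:R / z :> R.
  by rewrite powRB ?(gt_eqF NR) ?implybT // powRr1.
rewrite mulrCA ler_pM2l //.
rewrite ler_pdivlMr ?(lt_le_trans ltr01) // ler_pdivrMl ?(lt_le_trans ltr01) //.
rewrite -natr1 in zY; lra.
Qed.

Theorem theorem1p1 (R : realType) (alpha1 alpha2 beta : R)
    (d : nat) (hd : (2 <= d)%N)
    (p : {poly R}) (p_monic : p \is monic) (deg_p : size p = d.+1)
    (t : R) (ht : 0 < t)
    (hft : finite_type
       (\row_(j < 3) [:: alpha2; alpha1 * alpha2; alpha1 * alpha2 * beta]`_j) t) :
  let f := nested_floor alpha1 alpha2 beta p in
  exists2 eta : R, 0 < eta &
    forall eps : R, 0 < eps ->
      exists2 C : R, 0 < C &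
        forall N : nat, (0 < N)%N ->
          well_distribution N (fun n => chi (f n%:R))
            <= C * N%:R `^ (1 - eta + eps).
Proof.
move=> f; case: d hd deg_p => // d' _ deg_p'.
have [P P0 [C C0 hC]] := progression_sum_le p_monic deg_p' hft.
(* The progression bound saves a factor [Y], and [Y] can be taken of order [N ^ (1 / P)]. *)
exists P%:R^-1; first by rewrite invr_gt0 ltr0n.
move=> eps eps0; exists (2 * C) => [|N N0]; first by rewrite mulr_gt0.
have N1 : 1 <= N%:R :> R by rewrite ler1n.
have bound0 : 0 <= 2 * C * N%:R `^ (1 - P%:R^-1 + eps).
  by rewrite !mulr_ge0 ?powR_ge0 // ltW.
rewrite /well_distribution; set S := (X in sup X).
have [->|/set0P S0] := eqVneq S set0; first by rewrite sup0.
apply: ge_sup => // _ [a [b [M [a0 _ ab abM ->]]]].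
have [Y /andP[Y0 YN] NY] := exists_nat_root R P0 N0.
apply: le_trans (hC N Y a M b Y0 YN a0 ab abM) _.
rewrite (mulrC 2) -mulrA ler_pM2l // (le_trans NY) // ler_pM2l //.
by rewrite ler_powR // lerDl ltW.
Qed.
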